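(* Let $k$ and $\omega$ be two circles in the plane such that $\omega$ lies inside $k$. For any line $t$ tangent to $\omega$, let $\omega_1$ and $\omega_2$ be the two circles which are tangent externally to $\omega$, tangent internally to $k$, tangent to $t$, and lie on the same side of $t$ as $\omega$. Suppose that for every tangent line $t$ of $\omega$ the circles $\omega$, $\omega_1$, $\omega_2$ have a second common external tangent $u \neq t$. Then, as $t$ varies over all tangent lines of $\omega$, the intersection point $t \cap u$ describes a straight line.
   Context: A common external tangent of several circles is a line tangent to all of them and having all of them on the same side. Intersections are taken in the projective plane (the Euclidean plane extended by the line at infinity): if $t$ and $u$ are parallel, $t \cap u$ is their common point at infinity, and the straight line described may be the line at infinity (this is the case when $k$ and $\omega$ are concentric). *)

(* Defs.v *)
From HB Require Import structures.
From mathcomp Require Import all_boot all_order all_algebra.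
From mathcomp Require Import boolp classical_sets reals.

Set Implicit Arguments.
Unset Strict Implicit.
Unset Printing Implicit Defensive.

Import Order.TTheory GRing.Theory Num.Theory.

Local Open Scope classical_set_scope.
Local Open Scope ring_scope.

(* The Euclidean plane is 'rV[R]_2 with the distance below;
   MathComp-Analysis puts the sup norm on matrices, hence the explicit formula. *)
Definition dist (R : realType) (P Q : 'rV[R]_2) : R :=
  Num.sqrt (\sum_(i < 2) (P 0 i - Q 0 i) ^+ 2).

Record circle (R : realType) := Circle {
  center : 'rV[R]_2;
  radius : R;
  radius_gt0 : 0 < radius
}.

Definition on_circle (R : realType) (c : circle R) : set 'rV[R]_2 :=
  [set P | dist (center c) P = radius c].

Definition interior (R : realType) (c : circle R) : set 'rV[R]_2 :=
  [set P | dist (center c) P < radius c].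

(* The projective plane consists of the linear subspaces of R^3: points have
   dimension 1, lines have dimension 2, incidence is inclusion and the common
   point of two distinct lines t, u is (t :&: u)%VS. The Euclidean point (x, y)
   is the point spanned by (x, y, 1); the line at infinity is z = 0. *)
Definition proj_point (R : realType) (X : {vspace 'rV[R]_3}) : Prop :=
  \dim X = 1%N.

Definition proj_line (R : realType) (l : {vspace 'rV[R]_3}) : Prop :=
  \dim l = 2%N.

Definition homog (R : realType) (P : 'rV[R]_2) : 'rV[R]_3 :=
  row_mx P (1%:M : 'M[R]_1).

Definition on_line (R : realType) (l : {vspace 'rV[R]_3}) : set 'rV[R]_2 :=
  [set P | homog P \in l].

(* The line at infinity has no Euclidean point, so it is tangent to no circle. *)
Definition tangent_line (R : realType) (t : {vspace 'rV[R]_3})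
    (c : circle R) : Prop :=
  proj_line t /\ exists! P, on_circle c P /\ on_line t P.

Definition inside (R : realType) (c k : circle R) : Prop :=
  on_circle c `<=` interior k.

Definition externally_tangent (R : realType) (c d : circle R) : Prop :=
  (exists! P, on_circle c P /\ on_circle d P) /\
  interior c `&` interior d = set0.

(* c touches k from within. *)
Definition internally_tangent (R : realType) (c k : circle R) : Prop :=
  (exists! P, on_circle c P /\ on_circle k P) /\
  interior c `<=` interior k.

(* Points of the circles lying on t itself are disregarded, so that circles
   touching t are allowed; a circle crossing t is on the same side as none. *)
Definition same_side (R : realType) (t : {vspace 'rV[R]_3})
    (c d : circle R) : Prop :=
  forall P Q : 'rV[R]_2,
    on_circle c P -> ~ on_line t P -> on_circle d Q -> ~ on_line t Q ->
    forall a : R, 0 <= a <= 1 -> ~ on_line t ((1 - a) *: P + a *: Q).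

Definition common_external_tangent (R : realType) (t : {vspace 'rV[R]_3})
    (C : set (circle R)) : Prop :=
  (forall c, C c -> tangent_line t c) /\
  (forall c d, C c -> C d -> same_side t c d).

Definition touching_circle (R : realType) (k omega : circle R)
    (t : {vspace 'rV[R]_3}) (c : circle R) : Prop :=
  [/\ externally_tangent c omega, internally_tangent c k,
      tangent_line t c & same_side t c omega].

(* For omega inside k and t tangent to omega exactly two circles are touching,
   so any two distinct ones are "the" two circles. *)
Definition touching_pair (R : realType) (k omega : circle R)
    (t : {vspace 'rV[R]_3}) (omega1 omega2 : circle R) : Prop :=
  [/\ omega1 <> omega2, touching_circle k omega t omega1
    & touching_circle k omega t omega2].

Definition second_tangent (R : realType) (omega omega1 omega2 : circle R)
    (t u : {vspace 'rV[R]_3}) : Prop :=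
  u <> t /\ common_external_tangent u [set omega; omega1; omega2].

Definition intersection_locus (R : realType) (k omega : circle R) :
    set {vspace 'rV[R]_3} :=
  [set X | exists t u omega1 omega2,
    [/\ tangent_line t omega, touching_pair k omega t omega1 omega2,
        second_tangent omega omega1 omega2 t u & X = (t :&: u)%VS]].

(* Main.v *)
Require Import Defs.
From HB Require Import structures.
From mathcomp Require Import all_boot all_order all_algebra.
From mathcomp Require Import boolp classical_sets reals.
From mathcomp Require Import ring lra.

(** Let omega have centre O and radius r, let k have centre O + D and radius K,
    and let n be the unit normal of t. A circle of radius x touching omega, k
    and t has its centre at O + (r - x) n + q n', where n' is the unit direction
    of t and q ^ 2 = 4 r x; tangency to k makes q a root of a quadratic with
    sum of roots 4 r (D.n') / (r + K + D.n). If both circles touch a line u with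
    unit normal m, then q is also a root of a quadratic with sum of roots
    - 4 r (m.n') / (1 - m.n). Equating the two sums shows that t meets u in its
    intersection with the fixed line D.(P - O) = - r (r + K), which is the line
    at infinity when D = 0. Since |D| < K this line misses omega, so every point
    of it lies on a tangent t. *)

Set Implicit Arguments.
Unset Strict Implicit.
Unset Printing Implicit Defensive.

Import Order.TTheory GRing.Theory Num.Theory.

Local Open Scope classical_set_scope.
Local Open Scope ring_scope.

(** * Distances and tangent circles *)

Definition pt (R : realType) (x y : R) : 'rV[R]_2 :=
  \row_j (if j == 0 then x else y).

Lemma pt0 (R : realType) (x y : R) : pt x y 0 0 = x.
Proof. by rewrite mxE. Qed.

Lemma pt1 (R : realType) (x y : R) : pt x y 0 1 = y.
Proof. by rewrite mxE. Qed.

Lemma pt_eq (R : realType) (P Q : 'rV[R]_2) :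
  P 0 0 = Q 0 0 -> P 0 1 = Q 0 1 -> P = Q.
Proof.
move=> h0 h1; apply/rowP => j; case: (unliftP 0 j) => [i|] -> //.
by rewrite (_ : lift 0 i = 1) //; apply/val_inj; rewrite /= (ord1 i).
Qed.

(** Being polynomial in the coordinates, this form of the distance is accessible to [ring] and
    [lra]. *)
Definition sqd (R : realType) (P Q : 'rV[R]_2) : R :=
  (P 0 0 - Q 0 0) ^+ 2 + (P 0 1 - Q 0 1) ^+ 2.

Lemma sqd_ge0 (R : realType) (P Q : 'rV[R]_2) : 0 <= sqd P Q.
Proof. by rewrite addr_ge0 ?sqr_ge0. Qed.

Lemma distE (R : realType) (P Q : 'rV[R]_2) : dist P Q = Num.sqrt (sqd P Q).
Proof.
by rewrite /dist big_ord_recl big_ord1 (_ : lift 0 0 = 1) //; apply/val_inj.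
Qed.

Lemma dist_ge0 (R : realType) (P Q : 'rV[R]_2) : 0 <= dist P Q.
Proof. by rewrite distE sqrtr_ge0. Qed.

Lemma sqr_dist (R : realType) (P Q : 'rV[R]_2) : dist P Q ^+ 2 = sqd P Q.
Proof. by rewrite distE sqr_sqrtr ?sqd_ge0. Qed.

Lemma dist_eqP (R : realType) (P Q : 'rV[R]_2) (r : R) :
  0 <= r -> dist P Q = r <-> sqd P Q = r ^+ 2.
Proof.
move=> r0; rewrite -sqr_dist; split=> [-> //|/eqP].
by rewrite eqrXn2 ?dist_ge0 // => /eqP.
Qed.

Lemma distC (R : realType) (P Q : 'rV[R]_2) : dist P Q = dist Q P.
Proof. by rewrite !distE; congr Num.sqrt; rewrite /sqd; ring. Qed.

(** By Lagrange's identity the two sides, once squared, differ by [(a * d - b * c) ^+ 2]. *)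
Lemma cauchy_schwarz2 (R : realType) (a b c d s t : R) :
  0 <= s -> 0 <= t -> a ^+ 2 + b ^+ 2 = s ^+ 2 -> c ^+ 2 + d ^+ 2 = t ^+ 2 ->
  a * c + b * d <= s * t.
Proof.
move=> s0 t0 hs ht; have st : 0 <= s * t by exact: mulr_ge0.
have [neg|/ltW pos] := leP (a * c + b * d) 0; first exact: le_trans neg st.
rewrite -(@ler_pXn2r _ 2) ?nnegrE // exprMn -hs -ht -subr_ge0.
rewrite [X in 0 <= X](_ : _ = (a * d - b * c) ^+ 2) ?sqr_ge0 //; ring.
Qed.

Lemma dist_triangle (R : realType) (Q P S : 'rV[R]_2) :
  dist P S <= dist P Q + dist Q S.
Proof.
rewrite -(@ler_pXn2r _ 2) ?nnegrE ?addr_ge0 ?dist_ge0 //.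
have := cauchy_schwarz2 (dist_ge0 P Q) (dist_ge0 Q S)
  (esym (sqr_dist P Q)) (esym (sqr_dist Q S)).
rewrite sqrrD !sqr_dist /sqd => h.
rewrite mulr2n; nra.
Qed.

Lemma polar (R : realType) (P Q : 'rV[R]_2) : exists a b : R,
  [/\ a ^+ 2 + b ^+ 2 = 1, P 0 0 - Q 0 0 = a * dist P Q
    & P 0 1 - Q 0 1 = b * dist P Q].
Proof.
have := sqr_dist P Q; rewrite /sqd; have [->|nz h] := eqVneq (dist P Q) 0.
  rewrite expr0n /= => /esym/eqP.
  rewrite paddr_eq0 ?sqr_ge0 // !sqrf_eq0 => /andP[/eqP-> /eqP->].
  (* For coinciding points any unit vector serves as direction, so concentric circles need no
     separate treatment later. *)
  by exists 1, 0; split; ring.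
exists ((P 0 0 - Q 0 0) / dist P Q), ((P 0 1 - Q 0 1) / dist P Q).
split; rewrite ?divfK // !expr_div_n -mulrDl -h divff //.
by rewrite expf_neq0.
Qed.

Lemma dist_polar (R : realType) (P Q : 'rV[R]_2) (a b l : R) :
  a ^+ 2 + b ^+ 2 = 1 -> 0 <= l ->
  P 0 0 - Q 0 0 = a * l -> P 0 1 - Q 0 1 = b * l -> dist P Q = l.
Proof.
move=> ab l0 e0 e1; apply/dist_eqP => //.
by rewrite /sqd e0 e1 !exprMn -mulrDl ab mul1r.
Qed.

(** The triangle inequality through the contact point bounds the distance from above. Were the
    centres closer, the point dividing their segment in the ratio of the radii would lie in both
    interiors. *)
Lemma external_dist (R : realType) (c d : circle R) :
  externally_tangent c d ->
  dist (center c) (center d) = radius c + radius d.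
Proof.
case=> -[P [[Pc Pd] _]] disj.
have xc := radius_gt0 c; have xd := radius_gt0 d.
apply/eqP; rewrite eq_le; apply/andP; split.
  by rewrite -{1}Pc -Pd (distC (center d)) dist_triangle.
rewrite leNgt; apply/negP => lt.
set x := radius c in Pc xc lt *; set y := radius d in Pd xd lt *.
set f := x / (x + y).
have f0 : 0 < f by rewrite divr_gt0 ?addr_gt0.
have g0 : 0 < 1 - f.
  by rewrite subr_gt0 ltr_pdivrMr ?addr_gt0 // mul1r ltrDl.
have xyE : f * (x + y) = x by rewrite divfK // gt_eqF ?addr_gt0.
have [a [b [ab e0 e1]]] := polar (center d) (center c).
have dl := dist_ge0 (center d) (center c).
rewrite distC in lt; set l := dist _ _ in e0 e1 lt dl.
pose Q := pt (center c 0 0 + f * (a * l)) (center c 0 1 + f * (b * l)).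
suff : (interior c `&` interior d) Q by rewrite disj.
split; rewrite /interior /=.
  have -> : dist (center c) Q = f * l.
    rewrite distC; apply: (dist_polar ab); first by rewrite mulr_ge0 ?(ltW f0).
      by rewrite pt0; ring.
    by rewrite pt1; ring.
  by rewrite -/x -xyE ltr_pM2l.
have -> : dist (center d) Q = (1 - f) * l.
  apply: (dist_polar ab); first by rewrite mulr_ge0 ?(ltW g0).
    by rewrite pt0 opprD addrA e0; ring.
  by rewrite pt1 opprD addrA e1; ring.
rewrite -/y (_ : y = (1 - f) * (x + y)) ?ltr_pM2l //.
by rewrite mulrBl xyE; ring.
Qed.

(** The triangle inequality through the contact point gives one bound. Were the centres farther
    apart, the point of [k] on the ray from its centre through the centre of [c] would be interior
    to [c], hence to [k]. *)
Lemma internal_dist (R : realType) (c k : circle R) :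
  internally_tangent c k ->
  dist (center c) (center k) = radius k - radius c.
Proof.
case=> -[P [[Pc Pk] _]] sub.
have xc := radius_gt0 c; have xk := radius_gt0 k.
have in_k := sub (center c); rewrite /interior /= in in_k.
have dkc : dist (center k) (center c) < radius k.
  apply: in_k; rewrite (_ : dist _ _ = 0) //.
  by apply/dist_eqP => //; rewrite /sqd; ring.
apply/eqP; rewrite eq_le; apply/andP; split; last first.
  have := dist_triangle (center c) (center k) P.
  by rewrite Pc Pk lerBlDr distC.
rewrite leNgt; apply/negP => lt.
have [a [b [ab e0 e1]]] := polar (center c) (center k).
rewrite distC in dkc; set l := dist _ _ in e0 e1 lt dkc.
have l0 : 0 <= l by exact: dist_ge0.
set m := radius k - l.
have m0 : 0 <= m by rewrite subr_ge0 ltW.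
pose Q := pt (center c 0 0 + m * a) (center c 0 1 + m * b).
have Qc : interior c Q.
  rewrite /interior /= (_ : dist _ _ = m) ?ltrBlDl -?ltrBlDr //.
  by rewrite distC; apply: (dist_polar ab); rewrite ?pt0 ?pt1 //; ring.
have := sub _ Qc; rewrite /interior /= (_ : dist _ _ = radius k) ?ltxx //.
rewrite distC; apply: (dist_polar ab); first exact: ltW.
  by rewrite pt0 addrAC e0 /m; ring.
by rewrite pt1 addrAC e1 /m; ring.
Qed.

(** The bound is read off at the point of [c] farthest from the centre of [k]. *)
Lemma inside_dist (R : realType) (c k : circle R) :
  inside c k -> dist (center c) (center k) + radius c < radius k.
Proof.
move=> sub; have xc := radius_gt0 c.
have [a [b [ab e0 e1]]] := polar (center c) (center k).
pose Q := pt (center c 0 0 + radius c * a) (center c 0 1 + radius c * b).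
have Qc : on_circle c Q.
  rewrite /on_circle /= distC.
  by apply: (dist_polar ab); rewrite ?pt0 ?pt1 ?ltW //; ring.
have := sub _ Qc; rewrite /interior /=; congr (_ < _).
rewrite distC; apply: (dist_polar ab).
- by rewrite addr_ge0 ?dist_ge0 ?ltW.
- by rewrite pt0 addrAC e0; ring.
- by rewrite pt1 addrAC e1; ring.
Qed.

Lemma sum_sqr_eq0 (R : realType) (a b : R) :
  a ^+ 2 + b ^+ 2 = 0 -> a = 0 /\ b = 0.
Proof.
move/eqP; rewrite paddr_eq0 ?sqr_ge0 // !sqrf_eq0.
by move=> /andP[/eqP-> /eqP->].
Qed.

(* The radius of the second circle is y for an external and - y for an internal
   tangency. *)
Lemma tangency_point (R : realType) (c : circle R) (C : 'rV[R]_2) (y : R) :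
  radius c + y != 0 -> sqd (center c) C = (radius c + y) ^+ 2 ->
  exists! P, on_circle c P /\ sqd C P = y ^+ 2.
Proof.
move=> nz h; have xc := radius_gt0 c.
set x := radius c in nz h xc; set f := x / (x + y).
have fE : f * (x + y) = x by rewrite divfK.
have gE : (1 - f) * (x + y) = y by rewrite mulrBl fE; ring.
exists (pt (center c 0 0 + f * (C 0 0 - center c 0 0))
           (center c 0 1 + f * (C 0 1 - center c 0 1))); split.
  split; first (apply/dist_eqP; first exact: ltW).
    by rewrite -/x -fE exprMn -h /sqd pt0 pt1; ring.
  by rewrite -gE exprMn -h /sqd pt0 pt1; ring.
move=> P [/dist_eqP]; rewrite -/x => /(_ (ltW xc)) Pc Pd.
(* With A the centre of [c], this is the squared length of (x + y)(P - A) - x(C - A). It expands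
   into the three known squared distances and vanishes, which determines P. *)
have : ((x + y) * (P 0 0 - center c 0 0) - x * (C 0 0 - center c 0 0)) ^+ 2
     + ((x + y) * (P 0 1 - center c 0 1) - x * (C 0 1 - center c 0 1)) ^+ 2 = 0.
  rewrite [LHS](_ : _ = (x + y) ^+ 2 * sqd (center c) P
    - x * (x + y) * (sqd (center c) P + sqd (center c) C - sqd C P)
    + x ^+ 2 * sqd (center c) C); last by rewrite /sqd; ring.
  by rewrite Pc Pd h; ring.
move=> /sum_sqr_eq0[/eqP + /eqP].
rewrite !subr_eq0 => /eqP h0 /eqP h1.
apply: pt_eq; rewrite ?pt0 ?pt1; apply: (mulfI nz); apply/eqP; rewrite -subr_eq0.
  rewrite [X in X == 0](_ : _ = f * (x + y) * (C 0 0 - center c 0 0)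
    - (x + y) * (P 0 0 - center c 0 0)); last by ring.
  by rewrite fE h0 subrr.
rewrite [X in X == 0](_ : _ = f * (x + y) * (C 0 1 - center c 0 1)
  - (x + y) * (P 0 1 - center c 0 1)); last by ring.
by rewrite fE h1 subrr.
Qed.

Lemma dist_external (R : realType) (c d : circle R) :
  dist (center c) (center d) = radius c + radius d -> externally_tangent c d.
Proof.
move=> h; have xc := radius_gt0 c; have xd := radius_gt0 d.
have x0 : 0 < radius c + radius d by exact: addr_gt0.
split.
  have [|P [[Pc Pd] uP]] :=
      @tangency_point _ c (center d) (radius d) (lt0r_neq0 x0).
    by rewrite -sqr_dist h.
  exists P; split; first by split=> //; apply/dist_eqP => //; exact: ltW.
  by move=> Q [Qc /dist_eqP Qd]; apply: uP; split=> //; apply: Qd; exact: ltW.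
apply/seteqP; split=> // P [Pc Pd]; rewrite /interior /= in Pc Pd.
have := dist_triangle P (center c) (center d).
rewrite h (distC P) leNgt => /negP; apply; exact: ltrD.
Qed.

Lemma dist_internal (R : realType) (c k : circle R) :
  radius c < radius k ->
  dist (center c) (center k) = radius k - radius c -> internally_tangent c k.
Proof.
move=> lt h; have xc := radius_gt0 c; have xk := radius_gt0 k.
split.
  have nz : radius c + - radius k != 0 by rewrite subr_eq0 lt_eqF.
  have [|P [[Pc Pd] uP]] := @tangency_point _ c (center k) (- radius k) nz.
    by rewrite -sqr_dist h; ring.
  rewrite sqrrN in Pd uP.
  exists P; split; first by split=> //; apply/dist_eqP => //; exact: ltW.
  by move=> Q [Qc /dist_eqP Qd]; apply: uP; split=> //; apply: Qd; exact: ltW.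
move=> P; rewrite /interior /= => Pc.
have := dist_triangle (center c) (center k) P.
rewrite (distC (center k) (center c)) h => le.
by apply: (le_lt_trans le); rewrite -ltrBrDl; apply: (lt_le_trans Pc); lra.
Qed.

(** * Tangent lines in normal form *)

Definition dot3 (R : realType) (c v : 'rV[R]_3) : R := (v *m c^T) 0 0.

Lemma dot3E (R : realType) (c v : 'rV[R]_3) :
  dot3 c v = c 0 0 * v 0 0 + c 0 1 * v 0 1 + c 0 ord_max * v 0 ord_max.
Proof.
rewrite /dot3 mxE !big_ord_recl big_ord0 addr0 !mxE addrA.
have -> : lift ord0 ord0 = 1 :> 'I_3 by apply/val_inj.
have -> : lift ord0 (lift ord0 ord0) = ord_max :> 'I_3 by apply/val_inj.
by rewrite !(mulrC (v 0 _)).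
Qed.

Lemma row3_eq0 (R : realType) (v : 'rV[R]_3) :
  v 0 0 = 0 -> v 0 1 = 0 -> v 0 ord_max = 0 -> v = 0.
Proof.
move=> h0 h1 h2; apply/rowP => j; rewrite mxE.
case: (unliftP ord_max j) => [i ->|-> //].
by case: (unliftP 0 i) => [k ->|->];
  [rewrite -h1|rewrite -h0]; congr (v 0 _); apply/val_inj; rewrite ?(ord1 k).
Qed.

Lemma dim_rV (R : realType) n : \dim {: 'rV[R]_n} = n.
Proof. by rewrite dimvf /dim /= mul1n. Qed.

(** The form [dot3 c] is nonzero because its value at [c] itself is a sum of squares, not all zero;
    rank-nullity then gives a kernel of dimension 3 - 1. *)
Lemma kernel_line (R : realType) (c : 'rV[R]_3) : c != 0 ->
  exists t : {vspace 'rV[R]_3}, proj_line t /\ forall v, (v \in t) = (dot3 c v == 0).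
Proof.
move=> c0; pose f := linfun (mulmxr c^T : 'rV[R]_3 -> 'rV[R]_1).
have fE v : f v = v *m c^T by rewrite lfunE.
exists (lker f); split; last first.
  move=> v; rewrite memv_ker fE /dot3; apply/eqP/eqP => [->|h].
    by rewrite mxE.
  by apply/matrixP => i j; rewrite !ord1 h mxE.
have := limg_ker_dim f fullv; rewrite capfv dim_rV.
have : (\dim (limg f) <= 1)%N.
    by apply: (leq_trans (dimvS (subvf _))); rewrite dim_rV.
have : (0 < \dim (limg f))%N.
  rewrite lt0n dimv_eq0 -subv0; apply/negP => /subvP sub.
  have /sub : f c \in limg f by rewrite memv_img ?memvf.
  rewrite memv0 fE => /eqP /matrixP /(_ 0 0); rewrite mxE [RHS]mxE => h.
  have {}h : \sum_j c 0 j ^+ 2 = 0.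
    by apply: etrans h; apply: eq_bigr => j _; rewrite mxE expr2.
  move/negP: c0; apply; apply/eqP/rowP => j; rewrite mxE.
  move/eqP: h; rewrite psumr_eq0 => [/allP|i _]; last exact: sqr_ge0.
  by move=> /(_ j (mem_index_enum _)); rewrite sqrf_eq0 => /eqP.
by rewrite /proj_line; case: (\dim (limg f)) => [|[|]] // _ _; rewrite addn1 => -[].
Qed.

(** Pairing with the two basis vectors of [t] maps a space of dimension 3 to one of dimension 2, so
    some nonzero [c] is orthogonal to [t]. The kernel of [dot3 c] contains [t] and has the same
    dimension. *)
Lemma line_kernel (R : realType) (t : {vspace 'rV[R]_3}) : proj_line t ->
  exists2 c : 'rV[R]_3, c != 0 & forall v, (v \in t) = (dot3 c v == 0).
Proof.
move=> dt.
pose f := linfun (mulmxr (\matrix_(j < 3, i < 2) (vbasis t)`_i 0 j)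
  : 'rV[R]_3 -> 'rV[R]_2).
have : lker f != 0%VS.
  rewrite -dimv_eq0 -lt0n; have := limg_ker_dim f fullv; rewrite capfv dim_rV.
  have : (\dim (limg f) <= 2)%N.
    by apply: (leq_trans (dimvS (subvf _))); rewrite dim_rV.
  by case: (\dim (lker f)) => // + e; rewrite add0n in e; rewrite e.
move=> nz; pose c := vpick (lker f).
have c0 : c != 0 by rewrite vpick0.
have fc : f c = 0 by apply/eqP; rewrite -memv_ker memv_pick.
exists c => // v; have [l [dl lE]] := kernel_line c0.
rewrite -lE; suff -> : t = l by [].
apply/eqP; rewrite eqEdim dl dt leqnn andbT.
rewrite -(span_basis (vbasisP t)); apply/span_subvP => w /(nthP 0)[i].
rewrite size_tuple => + <-; rewrite {1}dt => i2; rewrite lE; apply/eqP.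
move/rowP: fc => /(_ (Ordinal i2)); rewrite lfunE /= !mxE => <-.
rewrite /dot3 mxE; apply: eq_bigr => j _; rewrite !mxE; exact: mulrC.
Qed.

Lemma homogE (R : realType) (P : 'rV[R]_2) :
  (homog P 0 0 = P 0 0) * (homog P 0 1 = P 0 1) * (homog P 0 ord_max = 1).
Proof.
split; first split.
- rewrite -[RHS](row_mxEl P (1%:M : 'M[R]_1)).
  by congr (row_mx _ _ _ _); apply/val_inj.
- rewrite -[RHS](row_mxEl P (1%:M : 'M[R]_1)).
  by congr (row_mx _ _ _ _); apply/val_inj.
- transitivity ((1%:M : 'M[R]_1) 0 0); last by rewrite mxE.
  rewrite -(row_mxEr P (1%:M : 'M[R]_1)).
  by congr (row_mx _ _ _ _); apply/val_inj.
Qed.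

(** The homogeneous form also covers the line at infinity, with [a = b = 0] and [h != 0]. *)
Definition line_eq (R : realType) (t : {vspace 'rV[R]_3}) (a b h : R) : Prop :=
  forall v, (v \in t) = (a * v 0 0 + b * v 0 1 == h * v 0 ord_max).

Lemma line_eqN (R : realType) (t : {vspace 'rV[R]_3}) (a b h : R) :
  line_eq t a b h -> line_eq t (- a) (- b) (- h).
Proof. by move=> tE v; rewrite tE !mulNr -opprD eqr_opp. Qed.

Lemma line_eq_inj (R : realType) (t u : {vspace 'rV[R]_3}) (a b h : R) :
  line_eq t a b h -> line_eq u a b h -> t = u.
Proof. by move=> tE uE; apply/vspaceP => v; rewrite tE uE. Qed.

Definition vec3 (R : realType) (a b h : R) : 'rV[R]_3 :=
  \row_j (if j == 0 then a else if j == 1 then b else h).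

Lemma vec3E (R : realType) (a b h : R) :
  (vec3 a b h 0 0 = a) * (vec3 a b h 0 1 = b) * (vec3 a b h 0 ord_max = h).
Proof. by rewrite !mxE. Qed.

Lemma line_eq_exists (R : realType) (a b h : R) :
  [|| a != 0, b != 0 | h != 0] ->
  exists2 t : {vspace 'rV[R]_3}, proj_line t & line_eq t a b h.
Proof.
move=> nz; have [|t [dt tE]] := @kernel_line R (vec3 a b (- h)).
  apply: contraTneq nz => /rowP e.
  move: (e 0) (e 1) (e ord_max); rewrite !vec3E !mxE => -> -> /eqP.
  by rewrite oppr_eq0 => /eqP->; rewrite eqxx.
by exists t => // v; rewrite tE dot3E !vec3E mulNr subr_eq0.
Qed.

Lemma line_eq_proj_line (R : realType) (t : {vspace 'rV[R]_3}) (a b h : R) :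
  [|| a != 0, b != 0 | h != 0] -> line_eq t a b h -> proj_line t.
Proof.
by move=> /line_eq_exists[u du uE] tE; rewrite (line_eq_inj tE uE).
Qed.

Lemma on_line_eq (R : realType) (t : {vspace 'rV[R]_3}) (a b h : R)
  (P : 'rV[R]_2) :
  line_eq t a b h -> on_line t P <-> a * P 0 0 + b * P 0 1 = h.
Proof.
by move=> tE; rewrite /on_line /= tE !homogE mulr1; split=> /eqP.
Qed.

(* The reflection of the contact point in the normal through the centre lies
   on both the circle and the line, so the contact point is the foot of that
   normal. *)
Lemma tangent_height (R : realType) (t : {vspace 'rV[R]_3}) (a b h : R)
  (c : circle R) :
  a ^+ 2 + b ^+ 2 = 1 -> line_eq t a b h -> tangent_line t c ->
  a * center c 0 0 + b * center c 0 1 = h - radius c \/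
  a * center c 0 0 + b * center c 0 1 = h + radius c.
Proof.
move=> ab tE [_ [P [[Pc Pt] uP]]]; have xc := radius_gt0 c.
have {}Pc := (dist_eqP _ _ (ltW xc)).1 Pc.
have {}Pt := (on_line_eq _ tE).1 Pt.
set x := radius c in xc Pc uP *; rewrite /sqd in Pc.
set p := center c 0 0 in Pc *; set q := center c 0 1 in Pc *.
set X := P 0 0 in Pc Pt; set Y := P 0 1 in Pc Pt.
set s := a * (X - p) + b * (Y - q).
have sE : s = h - (a * p + b * q) by rewrite -Pt /s; ring.
have abl : b ^+ 2 = 1 - a ^+ 2 by rewrite -ab; ring.
have QP : P = pt (2 * s * a + 2 * p - X) (2 * s * b + 2 * q - Y).
  apply: uP; split.
    apply/dist_eqP; first exact: ltW.
    rewrite /sqd pt0 pt1 -/p -/q -Pc.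
    transitivity (4 * s ^+ 2 * (a ^+ 2 + b ^+ 2)
      - 4 * s * (a * (X - p) + b * (Y - q)) + (p - X) ^+ 2 + (q - Y) ^+ 2).
      by ring.
    by rewrite -/s ab; ring.
  apply/(on_line_eq _ tE); rewrite pt0 pt1 -Pt.
  transitivity (2 * s * (a ^+ 2 + b ^+ 2) - 2 * (a * (X - p) + b * (Y - q))
    + a * X + b * Y); first by ring.
  by rewrite -/s ab; ring.
have hX : X = 2 * s * a + 2 * p - X by rewrite {1}/X QP pt0.
have hY : Y = 2 * s * b + 2 * q - Y by rewrite {1}/Y QP pt1.
have {}hX : p - X = - (s * a) by lra.
have {}hY : q - Y = - (s * b) by lra.
move: Pc; rewrite hX hY.
rewrite [LHS](_ : _ = s ^+ 2 * (a ^+ 2 + b ^+ 2)); last by ring.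
rewrite ab mulr1 => /eqP; rewrite eqf_sqr sE => /orP[] /eqP e; [left|right]; lra.
Qed.

(** The equation is scaled to a unit normal and signed so that the normal points from the centre
    towards [t]. Tangency on a given side thus becomes a linear equation in the centre and the
    radius. *)
Lemma tangent_normal (R : realType) (t : {vspace 'rV[R]_3}) (c : circle R) :
  tangent_line t c -> exists a b : R, a ^+ 2 + b ^+ 2 = 1 /\
    line_eq t a b (a * center c 0 0 + b * center c 0 1 + radius c).
Proof.
move=> tc; have [/line_kernel[f f0 fE] [P [[_ Pt] _]]] := tc.
have [l0 | l2] := eqVneq (f 0 0 ^+ 2 + f 0 1 ^+ 2) 0.
  (* A vanishing normal would make [t] the line at infinity, which has no Euclidean contact
     point. *)
  have [a0 b0] := sum_sqr_eq0 l0.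
  move: Pt; rewrite /on_line /= fE dot3E !homogE a0 b0 !mul0r !add0r mulr1.
  by move=> /eqP h0; case/eqP: f0; exact: row3_eq0.
have lpos : 0 < f 0 0 ^+ 2 + f 0 1 ^+ 2.
  by rewrite lt0r l2 addr_ge0 ?sqr_ge0.
set l := Num.sqrt (f 0 0 ^+ 2 + f 0 1 ^+ 2).
have l_gt0 : 0 < l by rewrite sqrtr_gt0.
have lE : l ^+ 2 = f 0 0 ^+ 2 + f 0 1 ^+ 2 by rewrite sqr_sqrtr ?ltW.
have ab : (f 0 0 / l) ^+ 2 + (f 0 1 / l) ^+ 2 = 1.
  by rewrite !expr_div_n -mulrDl -lE divff // expf_neq0 ?gt_eqF.
have tE : line_eq t (f 0 0 / l) (f 0 1 / l) (- f 0 ord_max / l).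
  move=> v; rewrite fE -[RHS]subr_eq0 [in RHS](_ : _ - _ = dot3 f v / l).
    by rewrite mulf_eq0 invr_eq0 (gt_eqF l_gt0) orbF.
  by rewrite dot3E; ring.
case: (tangent_height ab tE tc) => e.
  by exists (f 0 0 / l), (f 0 1 / l); rewrite e subrK.
(* Here the normal points from [t] towards the centre, so it is reversed. *)
exists (- (f 0 0 / l)), (- (f 0 1 / l)); split; first by rewrite !sqrrN.
rewrite !mulNr -opprD e (_ : _ + _ = - (- f 0 ord_max / l)); last by ring.
exact: line_eqN.
Qed.

Lemma normal_tangent (R : realType) (t : {vspace 'rV[R]_3}) (c : circle R)
  (a b h : R) :
  a ^+ 2 + b ^+ 2 = 1 -> line_eq t a b h ->
  a * center c 0 0 + b * center c 0 1 + radius c = h -> tangent_line t c.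
Proof.
move=> ab tE hE; have xc := radius_gt0 c; split.
  apply: line_eq_proj_line tE; rewrite orbA; apply/orP; left.
  rewrite -negb_and; apply: contra_eqN ab => /andP[/eqP-> /eqP->].
  by rewrite expr0n /= addr0 eq_sym oner_eq0.
exists (pt (center c 0 0 + a * radius c) (center c 0 1 + b * radius c)).
split.
  split; first by rewrite /on_circle /= distC;
    apply: (dist_polar ab); rewrite ?pt0 ?pt1 ?ltW //; ring.
  apply/(on_line_eq _ tE); rewrite pt0 pt1 -hE -[X in _ = _ + X]mul1r -ab; ring.
move=> P [/(dist_eqP _ _ (ltW xc)) Pc /(on_line_eq _ tE) Pt].
have : (P 0 0 - center c 0 0 - a * radius c) ^+ 2
     + (P 0 1 - center c 0 1 - b * radius c) ^+ 2 = 0.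
  transitivity (sqd (center c) P + (a ^+ 2 + b ^+ 2) * radius c ^+ 2
    - 2 * radius c * ((a * P 0 0 + b * P 0 1)
      - (a * center c 0 0 + b * center c 0 1))).
    by rewrite /sqd; ring.
  by rewrite Pc Pt ab -hE; ring.
by move=> /sum_sqr_eq0[h0 h1]; apply: pt_eq; rewrite ?pt0 ?pt1; lra.
Qed.

Lemma segmentE (R : realType) (P Q : 'rV[R]_2) (f : R) j :
  ((1 - f) *: P + f *: Q) 0 j = (1 - f) * P 0 j + f * Q 0 j.
Proof. by rewrite !mxE. Qed.

Lemma same_side_normal (R : realType) (t : {vspace 'rV[R]_3}) (c d : circle R)
  (a b h : R) :
  a ^+ 2 + b ^+ 2 = 1 -> line_eq t a b h ->
  a * center d 0 0 + b * center d 0 1 + radius d = h ->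
  tangent_line t c -> same_side t c d ->
  a * center c 0 0 + b * center c 0 1 + radius c = h.
Proof.
move=> ab tE dE tc side; have xc := radius_gt0 c; have xd := radius_gt0 d.
case: (tangent_height ab tE tc) => e; first by lra.
exfalso; set x := radius c in xc e; set y := radius d in xd dE.
(* With [c] beyond [t], P and Q are the points opposite to the contact points of [c] and [d]. Their
   heights over [t] are 2x and -2y, so the segment PQ crosses [t] at parameter x / (x + y). *)
pose P := pt (center c 0 0 + a * x) (center c 0 1 + b * x).
pose Q := pt (center d 0 0 + (- a) * y) (center d 0 1 + (- b) * y).
have PE : a * P 0 0 + b * P 0 1 = h + 2 * x.
  rewrite pt0 pt1; transitivity (a * center c 0 0 + b * center c 0 1
    + (a ^+ 2 + b ^+ 2) * x); first by ring.
  by rewrite e ab; ring.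
have QE : a * Q 0 0 + b * Q 0 1 = h - 2 * y.
  rewrite pt0 pt1; transitivity (a * center d 0 0 + b * center d 0 1
    - (a ^+ 2 + b ^+ 2) * y); first by ring.
  by rewrite ab -dE; ring.
have xy : 0 < x + y by exact: addr_gt0.
have fE : x / (x + y) * (x + y) = x by rewrite divfK ?gt_eqF.
apply: (side P Q _ _ _ _ (x / (x + y))).
- rewrite /on_circle /= distC -/x; apply: (dist_polar ab);
    by rewrite ?pt0 ?pt1 ?ltW //; ring.
- by move/(on_line_eq _ tE); rewrite PE; lra.
- rewrite /on_circle /= distC -/y; apply: (@dist_polar _ _ _ (- a) (- b));
    by rewrite ?sqrrN ?pt0 ?pt1 ?ltW //; ring.
- by move/(on_line_eq _ tE); rewrite QE; lra.
- apply/andP; split; first by rewrite divr_ge0 // ltW.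
  by rewrite ler_pdivrMr // mul1r lerDl ltW.
apply/(on_line_eq _ tE); set f := x / (x + y) in fE *.
rewrite !segmentE; transitivity ((1 - f) * (a * P 0 0 + b * P 0 1)
  + f * (a * Q 0 0 + b * Q 0 1)); first by ring.
rewrite PE QE; transitivity (h + 2 * x - 2 * (f * (x + y))); first by ring.
by rewrite fE; ring.
Qed.

Lemma on_circle_height (R : realType) (c : circle R) (P : 'rV[R]_2) (a b : R) :
  a ^+ 2 + b ^+ 2 = 1 -> on_circle c P ->
  a * P 0 0 + b * P 0 1 <= a * center c 0 0 + b * center c 0 1 + radius c.
Proof.
move=> ab; rewrite /on_circle /= distC => Pc; have xc := radius_gt0 c.
have h : (P 0 0 - center c 0 0) ^+ 2 + (P 0 1 - center c 0 1) ^+ 2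
  = radius c ^+ 2 by rewrite -Pc sqr_dist.
have ab' : a ^+ 2 + b ^+ 2 = 1 ^+ 2 by rewrite ab expr1n.
have := cauchy_schwarz2 ler01 (ltW xc) ab' h; lra.
Qed.

Lemma normal_same_side (R : realType) (t : {vspace 'rV[R]_3})
  (c d : circle R) (a b h : R) :
  a ^+ 2 + b ^+ 2 = 1 -> line_eq t a b h ->
  a * center c 0 0 + b * center c 0 1 + radius c = h ->
  a * center d 0 0 + b * center d 0 1 + radius d = h -> same_side t c d.
Proof.
move=> ab tE cE dE P Q Pc Pt Qd Qt f /andP[f0 f1] /(on_line_eq _ tE).
rewrite !segmentE => e.
have hP : a * P 0 0 + b * P 0 1 < h.
  rewrite lt_neqAle -{2}cE on_circle_height // andbT.
  by apply/eqP => /(on_line_eq _ tE).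
have hQ : a * Q 0 0 + b * Q 0 1 < h.
  rewrite lt_neqAle -{2}dE on_circle_height // andbT.
  by apply/eqP => /(on_line_eq _ tE).
(* Both points lie strictly below height [h], so this convex combination of positive depths cannot
   vanish. *)
have {}e : (1 - f) * (h - (a * P 0 0 + b * P 0 1))
  + f * (h - (a * Q 0 0 + b * Q 0 1)) = 0 by rewrite -{1 2}e; ring.
move: f0; rewrite le_eqVlt => /orP[/eqP f0|f0].
  by rewrite -f0 subr0 mul1r mul0r in e; lra.
have := mulr_gt0 f0 (_ : 0 < h - (a * Q 0 0 + b * Q 0 1)).
have := @mulr_ge0 _ (1 - f) (h - (a * P 0 0 + b * P 0 1)).
rewrite !subr_ge0 !subr_gt0 => /(_ f1 (ltW hP)) h1 /(_ hQ) h2; lra.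
Qed.

(** * The second tangent and the touching circles *)

(* In coordinates along and across the normal of t, centred at omega, a
   touching circle of radius x has its centre (p, q) with q ^ 2 = 4 r x. The
   tangency to k and the tangency to u both turn into quadratic equations for
   q; comparing their sums of roots ties the normal (a, b) of u to the
   centre (e0, e1) of k. *)
Lemma frame_direction (R : realType) (r K e0 e1 a b p1 q1 x1 p2 q2 x2 : R) :
  0 < r -> q1 != q2 ->
  p1 = r - x1 -> p1 ^+ 2 + q1 ^+ 2 = (r + x1) ^+ 2 ->
  (p1 - e0) ^+ 2 + (q1 - e1) ^+ 2 = (K - x1) ^+ 2 -> a * p1 + b * q1 = r - x1 ->
  p2 = r - x2 -> p2 ^+ 2 + q2 ^+ 2 = (r + x2) ^+ 2 ->
  (p2 - e0) ^+ 2 + (q2 - e1) ^+ 2 = (K - x2) ^+ 2 -> a * p2 + b * q2 = r - x2 ->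
  (r + K + e0) * b = - e1 * (1 - a).
Proof.
move=> r0 q12 -> ext1 int1 tan1 -> ext2 int2 tan2.
have y1 : q1 ^+ 2 = 4 * r * x1 by lra.
have y2 : q2 ^+ 2 = 4 * r * x2 by lra.
have nz : q1 - q2 != 0 by rewrite subr_eq0.
(* Multiplying by [q1 - q2] turns the sum of the roots into a difference of squares, which the two
   equations control; [sum_k] is obtained in the same way. *)
have sum_u : (1 - a) * (q1 + q2) = - (4 * r * b).
  apply: (mulIf nz); rewrite [LHS](_ : _ = (1 - a) * (q1 ^+ 2 - q2 ^+ 2)).
    rewrite y1 y2; have -> : (1 - a) * (4 * r * x1 - 4 * r * x2)
      = 4 * r * ((r - x2 - a * (r - x2)) - (r - x1 - a * (r - x1))) by ring.
    rewrite -{1}tan1 -{1}tan2; ring.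
  by ring.
have sum_k : (r + K + e0) * (q1 + q2) = 4 * r * e1.
  apply: (mulIf nz).
  rewrite [LHS](_ : _ = (r + K + e0) * (q1 ^+ 2 - q2 ^+ 2)); last by ring.
  rewrite y1 y2.
  have i1 : 2 * (r + K + e0) * x1 - 2 * e1 * q1
    = K ^+ 2 - r ^+ 2 + 2 * r * e0 - e0 ^+ 2 - e1 ^+ 2 by lra.
  have i2 : 2 * (r + K + e0) * x2 - 2 * e1 * q2
    = K ^+ 2 - r ^+ 2 + 2 * r * e0 - e0 ^+ 2 - e1 ^+ 2 by lra.
  have {}i1 : (r + K + e0) * (x1 - x2) = e1 * (q1 - q2) by lra.
  transitivity (4 * r * ((r + K + e0) * (x1 - x2))); first by ring.
  by rewrite i1; ring.
have r4 : 4 * r != 0 by rewrite mulf_neq0 ?gt_eqF // ltr0n.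
apply: (mulfI r4).
transitivity (- (r + K + e0) * (- (4 * r * b))); first by ring.
rewrite -sum_u; transitivity (- (1 - a) * ((r + K + e0) * (q1 + q2))).
  by ring.
by rewrite sum_k; ring.
Qed.

(** A vector of [t] is r z n + q n' in the frame of its normal n, so the equations of [u] and of the
    fixed line are both linear in z and q. After multiplication by the nonzero factors r + K + D.n
    and 1 - m.n they agree up to sign. Homogeneous coordinates let z = 0 cover parallel tangents. *)
Lemma frame_concurrence (R : realType) (r K D0 D1 a b m0 m1 X Y z : R) :
  a ^+ 2 + b ^+ 2 = 1 -> m0 ^+ 2 + m1 ^+ 2 = 1 -> (m0, m1) <> (a, b) ->
  0 < r + K + (a * D0 + b * D1) ->
  (r + K + (a * D0 + b * D1)) * (a * m1 - b * m0)
    = - (a * D1 - b * D0) * (1 - (a * m0 + b * m1)) ->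
  a * X + b * Y = r * z ->
  (m0 * X + m1 * Y == r * z) = (D0 * X + D1 * Y == - (r * (r + K)) * z).
Proof.
move=> ab mm neq.
set A := a * m0 + b * m1; set B := a * m1 - b * m0.
set e0 := a * D0 + b * D1; set e1 := a * D1 - b * D0 => E0 dir XY.
set q := a * Y - b * X.
have AB : A ^+ 2 + B ^+ 2 = 1.
  by transitivity ((a ^+ 2 + b ^+ 2) * (m0 ^+ 2 + m1 ^+ 2));
    [rewrite /A /B; ring|rewrite ab mm mulr1].
(* A is the cosine of the angle between the two unit normals, and these differ. *)
have A1 : 1 - A != 0.
  rewrite subr_eq0; apply/eqP => A1; apply: neq.
  have : (m0 - a) ^+ 2 + (m1 - b) ^+ 2 = 0.
    transitivity (a ^+ 2 + b ^+ 2 + (m0 ^+ 2 + m1 ^+ 2) - 2 * A).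
      by rewrite /A; ring.
    by rewrite ab mm -A1; ring.
  by move=> /sum_sqr_eq0[/subr0_eq-> /subr0_eq->].
have mE : m0 * X + m1 * Y = A * (r * z) + B * q.
  transitivity ((a ^+ 2 + b ^+ 2) * (m0 * X + m1 * Y)).
    by rewrite ab mul1r.
  by rewrite -XY /A /B /q; ring.
have DE : D0 * X + D1 * Y = e0 * (r * z) + e1 * q.
  transitivity ((a ^+ 2 + b ^+ 2) * (D0 * X + D1 * Y)).
    by rewrite ab mul1r.
  by rewrite -XY /e0 /e1 /q; ring.
rewrite mE DE -subr_eq0 -[RHS]subr_eq0.
rewrite -[LHS](inj_eq (mulfI (lt0r_neq0 E0))).
rewrite -[RHS](inj_eq (mulfI A1)) !mulr0 -[RHS]oppr_eq0.
congr (_ == _).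
transitivity ((r + K + e0) * B * q - (r + K + e0) * (1 - A) * (r * z)).
  by ring.
by rewrite dir; ring.
Qed.

Lemma circle_eq (R : realType) (c d : circle R) :
  center c = center d -> radius c = radius d -> c = d.
Proof.
case: c d => [C x xp] [D y yp] /= CD xy.
by subst D y; congr Circle; exact: eq_irrelevance.
Qed.

Lemma touching_equations (R : realType) (k omega c : circle R)
  (t : {vspace 'rV[R]_3}) (a b h : R) :
  a ^+ 2 + b ^+ 2 = 1 -> line_eq t a b h ->
  a * center omega 0 0 + b * center omega 0 1 + radius omega = h ->
  touching_circle k omega t c ->
  [/\ sqd (center c) (center omega) = (radius c + radius omega) ^+ 2,
      sqd (center c) (center k) = (radius k - radius c) ^+ 2
    & a * center c 0 0 + b * center c 0 1 + radius c = h].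
Proof.
move=> ab tE hE [/external_dist ext /internal_dist int tc side].
split; [by rewrite -ext sqr_dist|by rewrite -int sqr_dist|].
exact: same_side_normal side.
Qed.

(** The equation of [l] involves only [k] and [omega], so this equality serves both inclusions of
    the locus. *)
Lemma second_tangent_concurrence (R : realType) (k omega c d : circle R)
  (t u : {vspace 'rV[R]_3}) :
  inside omega k -> tangent_line t omega -> touching_pair k omega t c d ->
  second_tangent omega c d t u ->
  forall l : {vspace 'rV[R]_3},
  line_eq l (center k 0 0 - center omega 0 0) (center k 0 1 - center omega 0 1)
    ((center k 0 0 - center omega 0 0) * center omega 0 0
     + (center k 0 1 - center omega 0 1) * center omega 0 1
     - radius omega * (radius omega + radius k)) ->
  (t :&: u = t :&: l)%VS.
Proof.
move=> /inside_dist ins tom [cd tc td] [ut [utan uside]] l lE.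
have [a [b [ab tE]]] := tangent_normal tom.
have inom : [set omega; c; d] omega by left; left.
have inc : [set omega; c; d] c by left; right.
have ind : [set omega; c; d] d by right.
have [m0 [m1 [mm uE]]] := tangent_normal (utan _ inom).
have [extc intc hc] := touching_equations ab tE erefl tc.
have [extd intd hd] := touching_equations ab tE erefl td.
have uc := same_side_normal mm uE erefl (utan _ inc) (uside _ _ inc inom).
have ud := same_side_normal mm uE erefl (utan _ ind) (uside _ _ ind inom).
have r0 := radius_gt0 omega; have K0 := radius_gt0 k.
have dl := sqr_dist (center omega) (center k).
have neq : (m0, m1) <> (a, b).
  by case=> e0 e1; apply: ut; apply: line_eq_inj uE _; rewrite e0 e1.
set O0 := center omega 0 0 in tE uE lE hc hd uc ud dl.
set O1 := center omega 0 1 in tE uE lE hc hd uc ud dl.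
set r := radius omega in tE uE lE hc hd uc ud extc extd r0 ins.
set K := radius k in intc intd K0 ins lE.
set D0 := center k 0 0 - O0 in lE *; set D1 := center k 0 1 - O1 in lE *.
rewrite /sqd -/O0 -/O1 in extc extd intc intd dl.
have dle := dist_ge0 (center omega) (center k).
(* By Cauchy-Schwarz D.n is at least -|D|, and |D| + r < K. *)
have E0 : 0 < r + K + (a * D0 + b * D1).
  have ab' : (- a) ^+ 2 + (- b) ^+ 2 = 1 ^+ 2 by rewrite !sqrrN expr1n.
  have dl' : D0 ^+ 2 + D1 ^+ 2 = dist (center omega) (center k) ^+ 2.
    by rewrite dl /D0 /D1; ring.
  have := cauchy_schwarz2 ler01 dle ab' dl'; lra.
have dir : (r + K + (a * D0 + b * D1)) * (a * m1 - b * m0)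
    = - (a * D1 - b * D0) * (1 - (a * m0 + b * m1)).
  (* These are the coordinates of the centre of [e] along and across the normal of [t], with origin
     at the centre of [omega]; the next facts say that the change of frame is a rotation. *)
  pose p (e : circle R) := a * (center e 0 0 - O0) + b * (center e 0 1 - O1).
  pose q (e : circle R) := a * (center e 0 1 - O1) - b * (center e 0 0 - O0).
  have rot (s w s' w' : R) : (a * s + b * w - (a * s' + b * w')) ^+ 2
      + (a * w - b * s - (a * w' - b * s')) ^+ 2
      = (s - s') ^+ 2 + (w - w') ^+ 2.
    transitivity ((a ^+ 2 + b ^+ 2) * ((s - s') ^+ 2 + (w - w') ^+ 2)).
      by ring.
    by rewrite ab mul1r.
  have norm (e : circle R) : p e ^+ 2 + q e ^+ 2
      = (center e 0 0 - O0) ^+ 2 + (center e 0 1 - O1) ^+ 2.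
    transitivity ((a ^+ 2 + b ^+ 2) *
      ((center e 0 0 - O0) ^+ 2 + (center e 0 1 - O1) ^+ 2)).
      by rewrite /p /q; ring.
    by rewrite ab mul1r.
  have back (e : circle R) : center e 0 0 = O0 + a * p e - b * q e /\
      center e 0 1 = O1 + b * p e + a * q e.
    split.
      transitivity (O0 + (a ^+ 2 + b ^+ 2) * (center e 0 0 - O0)).
        by rewrite ab; ring.
      by rewrite /p /q; ring.
    transitivity (O1 + (a ^+ 2 + b ^+ 2) * (center e 0 1 - O1)).
      by rewrite ab; ring.
    by rewrite /p /q; ring.
  have tanu (e : circle R) : (a * m0 + b * m1) * p e
      + (a * m1 - b * m0) * q e
      = m0 * (center e 0 0 - O0) + m1 * (center e 0 1 - O1).
    transitivity ((a ^+ 2 + b ^+ 2) *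
      (m0 * (center e 0 0 - O0) + m1 * (center e 0 1 - O1))).
      by rewrite /p /q; ring.
    by rewrite ab mul1r.
  have pc : p c = r - radius c by rewrite /p; lra.
  have pd : p d = r - radius d by rewrite /p; lra.
  apply: (@frame_direction _ r K _ _ _ _ (p c) (q c) (radius c)
    (p d) (q d) (radius d)) => //.
  (* The offset q determines the radius through q ^ 2 = 4 r x, then p = r - x, hence the whole
     circle. *)
  - apply/eqP => qq; apply: cd.
    have xx : radius c = radius d.
      have r4 : 4 * r != 0 by rewrite mulf_neq0 ?gt_eqF // ltr0n.
      apply: (mulfI r4).
      have := norm c; have := norm d; rewrite extc extd pc pd qq; lra.
    have pp : p c = p d by rewrite pc pd xx.
    have [c0 c1] := back c; have [d0 d1] := back d.
    by apply: circle_eq => //; apply: pt_eq;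
      rewrite ?c0 ?c1 ?d0 ?d1 pp qq.
  - by rewrite norm extc addrC.
  - by rewrite rot -intc /D0 /D1; ring.
  - by rewrite tanu; lra.
  - by rewrite norm extd addrC.
  - by rewrite rot -intd /D0 /D1; ring.
  - by rewrite tanu; lra.
(* Only vectors of [t] matter. Moving the origin to the centre of [omega] subtracts multiples of the
   third coordinate. *)
apply/vspaceP => v; rewrite !memv_cap; case vt: (v \in t) => //=.
move: vt; rewrite tE uE lE => /eqP vt.
have vt' : a * (v 0 0 - O0 * v 0 ord_max) + b * (v 0 1 - O1 * v 0 ord_max)
    = r * v 0 ord_max by lra.
have := frame_concurrence ab mm neq E0 dir vt'.
rewrite -subr_eq0 -[RHS]subr_eq0 -[in X in _ -> X]subr_eq0 => e.
rewrite -[RHS]subr_eq0.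
transitivity (m0 * (v 0 0 - O0 * v 0 ord_max)
  + m1 * (v 0 1 - O1 * v 0 ord_max) - r * v 0 ord_max == 0).
  by congr (_ == _); ring.
by rewrite e; congr (_ == _); ring.
Qed.

(** * Existence of the two touching circles *)

(** Radius r s ^ 2 and offset 2 r s along [t] make the circle touch [t] and [omega] for every
    nonzero s; the quadratic in s expresses tangency to [k]. *)
Lemma touching_circle_root (R : realType) (k omega : circle R)
  (t : {vspace 'rV[R]_3}) (a b s : R) :
  let D0 := center k 0 0 - center omega 0 0 in
  let D1 := center k 0 1 - center omega 0 1 in
  let r := radius omega in let K := radius k in
  inside omega k -> a ^+ 2 + b ^+ 2 = 1 ->
  line_eq t a b (a * center omega 0 0 + b * center omega 0 1 + r) ->
  s != 0 ->
  2 * r * (r + K + (a * D0 + b * D1)) * s ^+ 2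
    - 2 * (2 * r * (a * D1 - b * D0)) * s
    - (K ^+ 2 - (D0 ^+ 2 + D1 ^+ 2) - r ^+ 2 + 2 * r * (a * D0 + b * D1)) = 0 ->
  exists c : circle R, touching_circle k omega t c /\
    a * (center c 0 1 - center omega 0 1) - b * (center c 0 0 - center omega 0 0)
      = 2 * r * s.
Proof.
move=> D0 D1 r K /inside_dist ins ab tE s0 root.
have r0 : 0 < r := radius_gt0 omega; have K0 : 0 < K := radius_gt0 k.
have x0 : 0 < r * s ^+ 2 by rewrite mulr_gt0 // exprn_even_gt0.
set x := r * s ^+ 2 in x0.
pose c := Circle (pt
  (center omega 0 0 + (a * (r * (1 - s ^+ 2)) - b * (2 * r * s)))
  (center omega 0 1 + (b * (r * (1 - s ^+ 2)) + a * (2 * r * s)))) x0.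
have ext : dist (center c) (center omega) = x + r.
  apply/dist_eqP; first by rewrite ltW // addr_gt0.
  rewrite /sqd pt0 pt1.
  transitivity ((a ^+ 2 + b ^+ 2)
    * ((r * (1 - s ^+ 2)) ^+ 2 + (2 * r * s) ^+ 2)); first by ring.
  by rewrite ab /x; ring.
have int2 : sqd (center c) (center k) = (K - x) ^+ 2.
  rewrite /sqd pt0 pt1.
  transitivity ((a ^+ 2 + b ^+ 2)
    * ((r * (1 - s ^+ 2)) ^+ 2 + (2 * r * s) ^+ 2) + (D0 ^+ 2 + D1 ^+ 2)
    - 2 * r * (1 - s ^+ 2) * (a * D0 + b * D1)
    - 4 * r * s * (a * D1 - b * D0)); first by rewrite /D0 /D1; ring.
  by rewrite ab; apply/eqP; rewrite -subr_eq0 -root /x; apply/eqP; ring.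
(* The squared equation leaves the sign of K - x open. If K <= x, the triangle inequality would give
   K + r <= |D|, against |D| + r < K. *)
have xK : x < K.
  rewrite ltNge; apply/negP => Kx.
  have h : dist (center c) (center k) = x - K.
    by apply/dist_eqP; rewrite ?subr_ge0 // int2; ring.
  have := dist_triangle (center k) (center c) (center omega).
  by rewrite ext h (distC (center k)); rewrite -/r -/K in ins; lra.
have int : dist (center c) (center k) = K - x.
  by apply/dist_eqP; rewrite ?subr_ge0 ?ltW.
have h : a * center c 0 0 + b * center c 0 1 + radius c
    = a * center omega 0 0 + b * center omega 0 1 + r.
  rewrite /= pt0 pt1; transitivity (a * center omega 0 0
    + b * center omega 0 1 + (a ^+ 2 + b ^+ 2) * (r * (1 - s ^+ 2)) + x).
    by ring.
  by rewrite ab /x; ring.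
exists c; split; first split.
- exact: dist_external.
- exact: dist_internal.
- exact: normal_tangent ab tE h.
- exact: normal_same_side ab tE h erefl.
rewrite pt0 pt1; transitivity ((a ^+ 2 + b ^+ 2) * (2 * r * s)).
  by ring.
by rewrite ab mul1r.
Qed.

(** The reduced discriminant [B ^+ 2 + A * C] is positive, and [C] being nonzero excludes the root
    0. *)
Lemma quadratic_roots (R : realType) (A B C : R) : 0 < A -> 0 < C ->
  exists s1 s2 : R, [/\ s1 != s2, s1 != 0, s2 != 0,
    A * s1 ^+ 2 - 2 * B * s1 - C = 0 & A * s2 ^+ 2 - 2 * B * s2 - C = 0].
Proof.
move=> A0 C0; have d0 : 0 < B ^+ 2 + A * C.
  by rewrite ltr_wpDl ?sqr_ge0 ?mulr_gt0.
set d := Num.sqrt (B ^+ 2 + A * C).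
have dE : d ^+ 2 = B ^+ 2 + A * C by rewrite sqr_sqrtr ?ltW.
have d_gt0 : 0 < d by rewrite sqrtr_gt0.
have Anz := lt0r_neq0 A0.
have root f : f ^+ 2 = d ^+ 2 ->
    A * ((B + f) / A) ^+ 2 - 2 * B * ((B + f) / A) - C = 0.
  move=> fd; transitivity ((f ^+ 2 - (B ^+ 2 + A * C)) / A); first by field.
  by rewrite fd dE subrr mul0r.
have nz s : A * s ^+ 2 - 2 * B * s - C = 0 -> s != 0.
  move=> e; apply/eqP => s0; move: e; rewrite s0; lra.
have r1 := root d erefl; have r2 := root (- d) (sqrrN d).
exists ((B + d) / A), ((B + - d) / A); split=> //; try exact: nz.
rewrite (inj_eq (mulIf (invr_neq0 Anz))); apply/eqP; lra.
Qed.

Lemma touching_pair_exists (R : realType) (k omega : circle R)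
  (t : {vspace 'rV[R]_3}) : inside omega k -> tangent_line t omega ->
  exists c d : circle R, touching_pair k omega t c d.
Proof.
move=> ins /tangent_normal[a [b [ab tE]]].
have lt := inside_dist ins.
have r0 := radius_gt0 omega; have K0 := radius_gt0 k.
have dl := sqr_dist (center k) (center omega); rewrite /sqd in dl.
have dle := dist_ge0 (center k) (center omega).
rewrite distC in lt; set l := dist _ _ in dl lt dle.
have ab' : a ^+ 2 + b ^+ 2 = 1 ^+ 2 by rewrite ab expr1n.
have ab'' : (- a) ^+ 2 + (- b) ^+ 2 = 1 ^+ 2 by rewrite !sqrrN expr1n.
have le := cauchy_schwarz2 ler01 dle ab'' (esym dl).
set D0 := center k 0 0 - center omega 0 0 in dl le.
set D1 := center k 0 1 - center omega 0 1 in dl le.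
set r := radius omega in lt r0; set K := radius k in lt K0.
have A0 : 0 < 2 * r * (r + K + (a * D0 + b * D1)).
  by rewrite mulr_gt0 ?mulr_gt0 ?ltr0n //; lra.
(* The constant term equals (K - l - r)(K + l + r) + 2 r (l + D.n), where l = |D|; the first product
   is positive and the second term nonnegative. *)
have C0 : 0 < K ^+ 2 - (D0 ^+ 2 + D1 ^+ 2) - r ^+ 2 + 2 * r * (a * D0 + b * D1).
  rewrite -dl; have := mulr_ge0 (ltW r0) (_ : 0 <= l + (a * D0 + b * D1)).
  have : 0 < (K - (l + r)) * (K + (l + r)).
    by apply: mulr_gt0; lra.
  move=> h1 h2; have {}h2 := h2 ltac:(lra); lra.
have [s1 [s2 [s12 s10 s20 e1 e2]]] :=
  quadratic_roots (2 * r * (a * D1 - b * D0)) A0 C0.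
have [c [tc hc]] := touching_circle_root ins ab tE s10 e1.
have [d [td hd]] := touching_circle_root ins ab tE s20 e2.
exists c, d; split=> // cd; move/eqP: s12; apply.
apply: (mulfI (_ : 2 * r != 0)); first by rewrite mulf_neq0 ?gt_eqF ?ltr0n.
by rewrite -hc -hd cd.
Qed.

(** * Tangents through a given point, and the locus *)

(** The unit normal must satisfy a X + b Y = r z. It is the sum of a multiple of (X, Y) and a
    multiple of (-Y, X), and the square root [S] is real because the point is not inside the circle.
    Points at infinity are included. *)
Lemma tangent_through (R : realType) (c : circle R) (v : 'rV[R]_3) :
  let X := v 0 0 - center c 0 0 * v 0 ord_max in
  let Y := v 0 1 - center c 0 1 * v 0 ord_max in
  0 < X ^+ 2 + Y ^+ 2 -> (radius c * v 0 ord_max) ^+ 2 <= X ^+ 2 + Y ^+ 2 ->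
  exists2 t : {vspace 'rV[R]_3}, tangent_line t c & v \in t.
Proof.
move=> X Y N0 le; set r := radius c in le *; set z := v 0 ord_max in X Y N0 le *.
set N := X ^+ 2 + Y ^+ 2 in N0 le; have Nnz := lt0r_neq0 N0.
set S := Num.sqrt (N - (r * z) ^+ 2).
have SE : S ^+ 2 = N - (r * z) ^+ 2 by rewrite sqr_sqrtr // subr_ge0.
set a := (r * z * X - S * Y) / N; set b := (r * z * Y + S * X) / N.
have ab : a ^+ 2 + b ^+ 2 = 1.
  transitivity (((r * z) ^+ 2 + S ^+ 2) * (X ^+ 2 + Y ^+ 2) / (N * N)).
    by rewrite /a /b; field.
  by rewrite SE -/N; field.
have abz : a * X + b * Y = r * z.
  transitivity (r * z * (X ^+ 2 + Y ^+ 2) / N); first by rewrite /a /b; field.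
  by rewrite -/N; field.
have nz : [|| a != 0, b != 0 | a * center c 0 0 + b * center c 0 1 + r != 0].
  rewrite orbA -negb_and; apply/orP; left.
  apply: contra_eqN ab => /andP[/eqP-> /eqP->].
  by rewrite expr0n /= addr0 eq_sym oner_eq0.
have [t _ tE] := line_eq_exists nz.
exists t; first exact: normal_tangent ab tE erefl.
by rewrite tE -/z mulrDl -abz /X /Y; apply/eqP; ring.
Qed.

Lemma line_cap (R : realType) (t u : {vspace 'rV[R]_3}) :
  proj_line t -> proj_line u -> t <> u -> proj_point (t :&: u)%VS.
Proof.
rewrite /proj_line /proj_point => dt du tu.
have := dimv_sum_cap t u; rewrite dt du.
have : (\dim (t + u) <= 3)%N.
  by apply: (leq_trans (dimvS (subvf _))); rewrite dim_rV.
have : (2 < \dim (t + u))%N.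
  rewrite ltnNge; apply/negP => le; apply: tu.
  have /eqP {1}-> : t == (t + u)%VS by rewrite eqEdim addvSl dt.
  by apply/esym/eqP; rewrite eqEdim addvSr du.
by case: (\dim (t + u)) => [|[|[|[|]]]] // _ _ [].
Qed.

Lemma second_tangent_point (R : realType) (omega c d : circle R)
  (t u : {vspace 'rV[R]_3}) :
  tangent_line t omega -> second_tangent omega c d t u ->
  proj_point (t :&: u)%VS.
Proof.
case=> dt _ [ut [utan _]]; apply: line_cap => //; last by move=> tu; apply: ut.
by case: (utan omega) => //; left; left.
Qed.

Theorem theorem2 (R : realType) (k omega : circle R)
    (omega_inside : inside omega k)
    (has_second_tangent :
      forall (t : {vspace 'rV[R]_3}) (omega1 omega2 : circle R),
        tangent_line t omega -> touching_pair k omega t omega1 omega2 ->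
        exists u : {vspace 'rV[R]_3}, second_tangent omega omega1 omega2 t u) :
  exists l : {vspace 'rV[R]_3},
    proj_line l /\
    intersection_locus k omega = [set X | proj_point X /\ (X <= l)%VS].
Proof.
have r0 := radius_gt0 omega; have K0 := radius_gt0 k.
have lt := inside_dist omega_inside; rewrite distC in lt.
have dl := sqr_dist (center k) (center omega); rewrite /sqd in dl.
have dle := dist_ge0 (center k) (center omega).
pose D0 := center k 0 0 - center omega 0 0.
pose D1 := center k 0 1 - center omega 0 1.
pose w := radius omega * (radius omega + radius k).
have w0 : 0 < w by rewrite mulr_gt0 ?addr_gt0.
(* For concentric circles D0 = D1 = 0 and the equation reduces to z = 0, the line at infinity, since
   [w] is nonzero. *)
have [|l dl2 lE] := @line_eq_exists R D0 D1
    (D0 * center omega 0 0 + D1 * center omega 0 1 - w).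
  have [->|] := eqVneq D0 0; have [->|] := eqVneq D1 0 => //=.
  by rewrite !mul0r !add0r oppr_eq0 gt_eqF.
exists l; split=> //; apply/seteqP; split=> X.
  move=> [t [u [c [d [tom pair sec ->]]]]].
  have -> := second_tangent_concurrence omega_inside tom pair sec lE.
  split; last exact: capvSr.
  rewrite -(second_tangent_concurrence omega_inside tom pair sec lE).
  exact: second_tangent_point sec.
move=> [dX Xl]; pose v := vpick X.
have v0 : v != 0 by rewrite vpick0 -dimv_eq0 dX.
have vX : v \in X := memv_pick X.
have := subvP Xl _ vX; rewrite lE => /eqP vl.
have {}vl : D0 * (v 0 0 - center omega 0 0 * v 0 ord_max)
    + D1 * (v 0 1 - center omega 0 1 * v 0 ord_max) = - w * v 0 ord_max by lra.
set P := v 0 0 - _ in vl; set Q := v 0 1 - _ in vl; set z := v 0 ord_max in P Q vl.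
(* If P = Q = 0, the equation of [l] forces z = 0 and then v = 0. *)
have N0 : 0 < P ^+ 2 + Q ^+ 2.
  rewrite lt0r addr_ge0 ?sqr_ge0 // andbT; apply: contra v0 => /eqP.
  move=> /sum_sqr_eq0[P0 Q0]; move: vl; rewrite P0 Q0 !mulr0 addr0.
  move=> /esym/eqP; rewrite mulf_eq0 oppr_eq0 (gt_eqF w0) /= => /eqP z0.
  move: P0 Q0; rewrite /P /Q z0 !mulr0 !subr0 => h0 h1.
  by apply/eqP; exact: row3_eq0.
(* The line [l] misses the interior of [omega]: by Cauchy-Schwarz (r (r + K) z) ^ 2 is at most |D| ^
   2 (P ^ 2 + Q ^ 2), and |D| < r + K. *)
have near : (radius omega * z) ^+ 2 <= P ^+ 2 + Q ^+ 2.
  have rK0 : 0 < (radius omega + radius k) ^+ 2 by rewrite exprn_gt0 ?addr_gt0.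
  rewrite -(ler_pM2l rK0).
  have -> : (radius omega + radius k) ^+ 2 * (radius omega * z) ^+ 2
    = (D0 * P + D1 * Q) ^+ 2 by rewrite vl /w; ring.
  apply: (@le_trans _ _ ((D0 ^+ 2 + D1 ^+ 2) * (P ^+ 2 + Q ^+ 2))).
    rewrite -subr_ge0 [X in 0 <= X](_ : _ = (D0 * Q - D1 * P) ^+ 2) ?sqr_ge0 //.
    by ring.
  rewrite ler_wpM2r ?(ltW N0) // -dl ler_pXn2r ?nnegrE //; lra.
have [t tom vt] := tangent_through N0 near.
have [c [d pair]] := touching_pair_exists omega_inside tom.
have [u sec] := has_second_tangent _ _ _ tom pair.
exists t, u, c, d; split=> //.
have dcap := second_tangent_point tom sec.
have Xv : X = <[v]>%VS.
  by apply/eqP; rewrite eq_sym eqEdim -memvE vX dX dim_vline v0.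
(* Both spaces have dimension 1, so it suffices that [X] lies in [t] and in [l]. *)
apply/eqP; rewrite eqEdim dX dcap leqnn andbT.
rewrite (second_tangent_concurrence omega_inside tom pair sec lE).
by rewrite subv_cap Xl andbT Xv -memvE.
Qed.
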